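(* Let $H$ be a strongly-connected digraph with at least two vertices. Then there is a function $f\colon\mathbb{N}\to\mathbb{N}$ such that for every semicomplete digraph $G$ and every positive integer $k$, one of the following holds: (1) $G$ has $k$ pairwise arc-disjoint subdigraphs, each containing $H$ as an immersion; or (2) there is a set $X\subseteq E(G)$ with $|X|\le f(k)$ such that $G\setminus X$ (the digraph obtained by deleting the arcs of $X$) does not contain $H$ as an immersion.
   Context: Digraphs are finite, may have multiple arcs, but have no loops; $E(G)$ is the multiset of arcs. A digraph is strongly-connected if it has at least one vertex and for all vertices $u,v$ there is a directed path from $u$ to $v$. A digraph is semicomplete if every two distinct vertices are joined by at least one arc (in some direction). $H$ is an immersion of $G$ if $G$ has a subdigraph obtained from a digraph isomorphic to $H$ by replacing each arc by a directed path in the same direction, these paths being pairwise arc-disjoint (they may share internal vertices). *)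

(* Defs.v *)
From mathcomp Require Import all_boot.

Set Implicit Arguments.
Unset Strict Implicit.
Unset Printing Implicit Defensive.

(* Parallel arcs are distinct elements of [diarc] with the same ends, so a
   submultiset of E(G) is a set of type {set diarc G}. *)
Record digraph := Digraph {
  vertex : finType;
  diarc : finType;
  src : diarc -> vertex;
  tgt : diarc -> vertex;
  loopless : forall a, src a != tgt a
}.

Arguments src {d}.
Arguments tgt {d}.

Section Paths.
Variable G : digraph.

(* A walk is given by its sequence of arcs. *)
Fixpoint diwalk (u : vertex G) (p : seq (diarc G)) (v : vertex G) : bool :=
  if p is a :: q then (src a == u) && diwalk (tgt a) q v else u == v.

Definition walk_vertices (u : vertex G) (p : seq (diarc G)) : seq (vertex G) :=
  u :: [seq tgt a | a <- p].

Definition dipath (u : vertex G) (p : seq (diarc G)) (v : vertex G) : bool :=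
  diwalk u p v && uniq (walk_vertices u p).

Definition strongly_connected : Prop :=
  0 < #|vertex G| /\ forall u v : vertex G, exists p, dipath u p v.

Definition semicomplete : Prop :=
  forall u v : vertex G, u != v ->
  exists a : diarc G, (src a = u /\ tgt a = v) \/ (src a = v /\ tgt a = u).

End Paths.

Record subdigraph (G : digraph) := Subdigraph {
  sub_vertices : {set vertex G};
  sub_arcs : {set diarc G};
  sub_src : forall a, a \in sub_arcs -> src a \in sub_vertices;
  sub_tgt : forall a, a \in sub_arcs -> tgt a \in sub_vertices
}.

Section DigraphOfSub.
Variables (G : digraph) (S : subdigraph G).

Let V : finType := {x : vertex G | x \in sub_vertices S}.
Let A : finType := {a : diarc G | a \in sub_arcs S}.

Definition sub_src_fun (a : A) : V := exist _ (src (val a)) (sub_src (valP a)).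
Definition sub_tgt_fun (a : A) : V := exist _ (tgt (val a)) (sub_tgt (valP a)).

Lemma sub_loopless (a : A) : sub_src_fun a != sub_tgt_fun a.
Proof. exact: (loopless (val a)). Qed.

Definition digraph_of_sub : digraph := Digraph sub_loopless.

End DigraphOfSub.

Section DeleteArcs.
Variables (G : digraph) (X : {set diarc G}).

Let A : finType := {a : diarc G | a \notin X}.

Definition del_src (a : A) : vertex G := src (val a).
Definition del_tgt (a : A) : vertex G := tgt (val a).

Lemma del_loopless (a : A) : del_src a != del_tgt a.
Proof. exact: (loopless (val a)). Qed.

Definition delete_arcs : digraph := Digraph del_loopless.

End DeleteArcs.

(* K arises from an isomorphic copy of H by replacing every arc e by a directed
   path P e, the paths being pairwise arc-disjoint: phi embeds the vertices of
   the copy, and K has no vertices or arcs besides those of the copy and of the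
   paths. The paths may meet in vertices, including vertices phi x; each P e is
   nonempty because phi is injective and H is loopless. *)
Definition path_replacement (H K : digraph) : Prop :=
  exists (phi : vertex H -> vertex K) (P : diarc H -> seq (diarc K)),
  [/\ injective phi,
      forall e, dipath (phi (src e)) (P e) (phi (tgt e)),
      forall e e', e != e' -> forall a, a \in P e -> a \notin P e',
      forall a : diarc K, exists e, a \in P e
    & forall v : vertex K,
        (exists x, v = phi x) \/
        (exists e, v \in walk_vertices (phi (src e)) (P e))].

Definition immersion (H G : digraph) : Prop :=
  exists S : subdigraph G, path_replacement H (digraph_of_sub S).

(* Main.v *)
Require Import Defs.
From Stdlib Require Import Classical.
From mathcomp Require Import all_boot all_algebra zify.

Set Implicit Arguments.
Unset Strict Implicit.
Unset Printing Implicit Defensive.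

(* Suppose that G has no k arc-disjoint immersions of H. Order the vertices by
   decreasing out-degree in a spanning tournament of G. If many vertices were
   joined in both directions to a common vertex by many short arc-disjoint
   walks, k arc-disjoint copies of H could be routed through that hub. Hence
   every vertex has few backward neighbours, and every cut of the ordering is
   crossed backwards by few pairs of vertices (each pair possibly with many
   parallel arcs). The same routing shows that two vertices x and y far apart in
   the ordering are not joined backwards by many arc-disjoint walks, so by
   Menger's theorem they are separated by few arcs, parallel ones included.
   Uniting these separators gives a chain of vertex sets, each entered by few
   arcs, with consecutive differences of bounded size. As H is strongly
   connected, after deleting the arcs entering one of these sets an immersion
   lies on one side of it. Cutting after the first set that contains H and
   deleting the arcs of low multiplicity in the last block, one reduces k by one:
   an immersion in the block that uses only arcs of high multiplicity could be
   repeated k times. *)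

(** * Walks and immersions *)

Section Walks.
Variable G : digraph.
Implicit Types (u v w : vertex G) (p q : seq (diarc G)) (a : diarc G).

Lemma diwalk_cat u p v q w :
  diwalk u p v -> diwalk v q w -> diwalk u (p ++ q) w.
Proof.
elim: p u => [|a p IHp] u /= => [/eqP -> //|/andP[-> pv] qw].
exact: IHp.
Qed.

Lemma src_walk_vertices u p v a :
  diwalk u p v -> a \in p -> src a \in walk_vertices u p.
Proof.
elim: p u => [|b p IHp] u //= /andP[/eqP <- pv].
rewrite inE => /predU1P[->|ap]; first by rewrite mem_head.
by rewrite inE IHp // orbT.
Qed.

Lemma dipath_suffix w q v u : dipath w q v -> u \in walk_vertices w q ->
  exists2 r, dipath u r v & {subset r <= q}.
Proof.
elim: q w => [|a q IHq] w.
  by move=> qv; rewrite inE => /eqP ->; exists [::].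
move=> wqv; rewrite inE => /predU1P[->|uq]; first by exists (a :: q).
have [|r uv rq] := IHq (tgt a) _ uq.
  by move: wqv; rewrite /dipath /= => /andP[/andP[_ ->] /andP[_]].
by exists r => // x /rq xq; rewrite inE xq orbT.
Qed.

(** Loop erasure from the far end: if [u] recurs on the shortened tail [r], only the part of [r]
    from [u] on is kept. *)
Lemma diwalk_shorten u q v : diwalk u q v ->
  exists2 r, dipath u r v & {subset r <= q}.
Proof.
elim: q u => [|a q IHq] u /=; first by move=> /eqP ->; exists [::]; rewrite /dipath /= ?eqxx.
case/andP=> /eqP srca /IHq[r rv rq].
have [ur|ur] := boolP (u \in walk_vertices (tgt a) r).
  have [s sv sr] := dipath_suffix rv ur.
  by exists s => // x /sr/rq xq; rewrite inE xq orbT.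
exists (a :: r).
  move: rv; rewrite /dipath /= srca eqxx /= => /andP[-> /= ->].
  by rewrite andbT.
by move=> x; rewrite !inE => /predU1P[->|/rq ->]; rewrite ?eqxx ?orbT.
Qed.

Lemma diwalk_escape u p v (A Z : {set _}) : {subset p <= A} ->
  (forall a, a \in A -> src a \notin Z -> tgt a \notin Z) ->
  diwalk u p v -> u \notin Z -> {in p, forall a, src a \notin Z /\ tgt a \notin Z} /\ v \notin Z.
Proof.
move=> + AZ; elim: p u => [|a p IHp] u pA /= => [/eqP -> //|].
case/andP=> /eqP srca pv uZ.
have tZ : tgt a \notin Z by apply: AZ; rewrite ?srca // pA // mem_head.
have [|IHpZ vZ] := IHp _ _ pv tZ; first by move=> x xp; rewrite pA // inE xp orbT.
split=> // b; rewrite inE => /predU1P[->|/IHpZ //]; by rewrite srca.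
Qed.

End Walks.

Section Maps.
Variables (K G : digraph) (fv : vertex K -> vertex G) (fa : diarc K -> diarc G).
Hypotheses (fv_inj : injective fv) (fsrc : forall a, src (fa a) = fv (src a))
  (ftgt : forall a, tgt (fa a) = fv (tgt a)).

Lemma diwalk_map u p v : diwalk u p v -> diwalk (fv u) (map fa p) (fv v).
Proof.
elim: p u => [|a p IHp] u /=; first by move=> /eqP ->.
by rewrite fsrc ftgt => /andP[/eqP -> /IHp ->]; rewrite eqxx.
Qed.

Lemma diwalk_lift u q v : {subset q <= codom fa} -> diwalk (fv u) q (fv v) ->
  exists2 p, q = map fa p & diwalk u p v.
Proof.
elim: q u => [|a q IHq] u qf /=.
  by move=> /eqP/fv_inj ->; exists [::] => //=.
have /codomP[a' ->] : a \in codom fa by apply: qf; rewrite mem_head.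
rewrite fsrc ftgt => /andP[/eqP/fv_inj srca qv].
have [|p -> pv] := IHq _ _ qv; first by move=> x xq; rewrite qf // inE xq orbT.
by exists (a' :: p) => //=; rewrite srca eqxx.
Qed.

End Maps.

Section Immersions.
Variable H : digraph.

Definition arc_disjoint (G : digraph) (I : Type) (P : I -> seq (diarc G)) :=
  forall i j a, a \in P i -> a \in P j -> i = j.

(* Walks rather than paths: by [diwalk_shorten] this makes no difference. *)
Definition immersed (G : digraph) (A : {set diarc G}) :=
  exists (phi : vertex H -> vertex G) (P : diarc H -> seq (diarc G)),
  [/\ injective phi, forall e, diwalk (phi (src e)) (P e) (phi (tgt e)),
      forall e, {subset P e <= A} & arc_disjoint P].

(** Copies are recorded by arc sets alone: the subdigraphs may share vertices, so each will simply
    take all of them. *)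
Definition packed (G : digraph) (k : nat) (A : {set diarc G}) :=
  exists F : 'I_k -> {set diarc G},
  (forall i j, i != j -> [disjoint F i & F j]) /\
  (forall i, F i \subset A /\ immersed (F i)).

Lemma immersedS (G : digraph) (A B : {set diarc G}) :
  A \subset B -> immersed A -> immersed B.
Proof.
move=> /subsetP AB [phi [P [inj W PA D]]]; exists phi, P; split=> // e a /PA.
exact: AB.
Qed.

Lemma immersion_immersed (G : digraph) (X : {set diarc G}) :
  immersion H (delete_arcs X) -> immersed (~: X).
Proof.
case=> S [phi [P [inj W D _ _]]].
exists (fun x => val (phi x)), (fun e => map (fun a => val (val a)) (P e)); split.
- exact: inj_comp val_inj inj.
- move=> e; have /andP[/diwalk_map W' _] := W e.
  exact: W'.
- by move=> e _ /mapP[a _ ->]; rewrite inE (valP (val a)).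
- move=> e e' _ /mapP[a aP ->] /mapP[b bP /val_inj/val_inj ab].
  by apply/eqP/negPn/negP => ee'; have := D _ _ ee' _ aP; rewrite ab bP.
Qed.

Section UnionOfPaths.
Variables (G : digraph) (phi : vertex H -> vertex G) (P : diarc H -> seq (diarc G)).
Hypotheses (phi_inj : injective phi) (disjP : arc_disjoint P)
  (pathP : forall e, dipath (phi (src e)) (P e) (phi (tgt e))).

Let arcsP : {set diarc G} := [set a | [exists e, a \in P e]].
Let vertsP : {set vertex G} := [set v | (v \in codom phi) ||
  [exists e, v \in walk_vertices (phi (src e)) (P e)]].

Lemma src_vertsP a : a \in arcsP -> src a \in vertsP.
Proof.
rewrite !inE => /existsP[e ae]; apply/orP; right; apply/existsP; exists e.
by have /andP[W _] := pathP e; apply: src_walk_vertices W ae.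
Qed.

Lemma tgt_vertsP a : a \in arcsP -> tgt a \in vertsP.
Proof.
rewrite !inE => /existsP[e ae]; apply/orP; right; apply/existsP; exists e.
by rewrite inE map_f ?orbT.
Qed.

Let S := Subdigraph src_vertsP tgt_vertsP.

(** [path_replacement] tolerates no extra vertices or arcs, so [S] is exactly the union of the
    paths, which are then lifted to its subtypes. *)
Lemma union_of_paths_immersion : immersion H G.
Proof.
exists S; pose K := digraph_of_sub S.
have phiV x : phi x \in sub_vertices S by rewrite inE codom_f.
pose psi x : vertex K := exist _ (phi x) (phiV x).
pose fv : vertex K -> vertex G := val; pose fa : diarc K -> diarc G := val.
have liftP e : exists p, (P e == map fa p) && diwalk (psi (src e)) p (psi (tgt e)).
  have /andP[W _] := pathP e.
  have [||||p -> ?] := @diwalk_lift K G fv fa _ _ _ (psi (src e)) (P e) (psi (tgt e)) _ W => //.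
  - exact: val_inj.
  - move=> a ae; have aS : a \in sub_arcs S by rewrite inE; apply/existsP; exists e.
    by apply/codomP; exists (exist _ a aS).
  - by exists p; apply/andP.
pose Q e := xchoose (liftP e).
have Qmap e : P e = map fa (Q e) by have /andP[/eqP] := xchooseP (liftP e).
have Qwalk e : diwalk (psi (src e)) (Q e) (psi (tgt e)).
  by have /andP[_] := xchooseP (liftP e).
have Qvert e : map fv (walk_vertices (psi (src e)) (Q e))
    = walk_vertices (phi (src e)) (P e).
  by rewrite Qmap /walk_vertices map_cons -!map_comp; congr cons; apply: eq_map.
exists psi, Q; split.
- by move=> x y /(congr1 val) /phi_inj.
- move=> e; rewrite /dipath Qwalk -(map_inj_uniq (f := fv)) ?Qvert; last exact: val_inj.
  by have /andP[_] := pathP e.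
- move=> e e' ee' a ae; apply: contra ee' => ae'; apply/eqP.
  by apply: (disjP (a := fa a)); rewrite Qmap map_f.
- move=> a; have := valP a; rewrite inE => /existsP[e].
  by rewrite Qmap (mem_map val_inj) => ae; exists e.
- move=> v; have := valP v; rewrite inE => /orP[/codomP[x vx]|/existsP[e]].
    by left; exists x; apply: val_inj.
  by rewrite -Qvert (mem_map val_inj) => ve; right; exists e.
Qed.

End UnionOfPaths.

Lemma immersed_immersion (G : digraph) (A : {set diarc G}) :
  immersed A -> immersion H G.
Proof.
case=> phi [P [phi_inj W _ D]].
have sh e : exists p, dipath (phi (src e)) p (phi (tgt e)) && all (mem (P e)) p.
  by have [p ? /allP ?] := diwalk_shorten (W e); exists p; apply/andP.
pose Q e := xchoose (sh e).
have QP e : {subset Q e <= P e}.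
  by have /andP[_ /allP] := xchooseP (sh e).
apply: (@union_of_paths_immersion G phi Q) => //.
- by move=> e e' a /QP ae /QP ae'; apply: D ae ae'.
- by move=> e; have /andP[] := xchooseP (sh e).
Qed.

Lemma immersed_sub (G : digraph) (S : subdigraph G) :
  sub_vertices S = setT -> immersed (sub_arcs S) -> immersion H (digraph_of_sub S).
Proof.
move=> ST [phi [P [phi_inj W PS D]]]; pose K := digraph_of_sub S.
have phiV x : phi x \in sub_vertices S by rewrite ST inE.
pose psi x : vertex K := exist _ (phi x) (phiV x).
pose fv : vertex K -> vertex G := val; pose fa : diarc K -> diarc G := val.
have liftP e : exists p, (P e == map fa p) && diwalk (psi (src e)) p (psi (tgt e)).
  have [||||p -> ?] := @diwalk_lift K G fv fa _ _ _ (psi (src e)) (P e) (psi (tgt e)) _ (W e) => //.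
  - exact: val_inj.
  - by move=> a /PS aS; apply/codomP; exists (exist _ a aS).
  - by exists p; apply/andP.
pose Q e := xchoose (liftP e).
have Qmap e : P e = map fa (Q e) by have /andP[/eqP] := xchooseP (liftP e).
apply: (@immersed_immersion K setT); exists psi, Q; split=> //.
- by move=> x y /(congr1 val) /phi_inj.
- by move=> e; have /andP[_] := xchooseP (liftP e).
- by move=> e a; rewrite inE.
- by move=> e e' a ae ae'; apply: (D _ _ (fa a)); rewrite Qmap map_f.
Qed.

Lemma packed_subdigraphs (G : digraph) (k : nat) (A : {set diarc G}) :
  packed k A -> exists S : 'I_k -> subdigraph G,
     (forall i j : 'I_k, i != j -> [disjoint sub_arcs (S i) & sub_arcs (S j)]) /\
     (forall i : 'I_k, immersion H (digraph_of_sub (S i))).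
Proof.
case=> F [D FP].
exists (fun i => @Subdigraph G setT (F i) (fun a _ => in_setT _) (fun a _ => in_setT _)).
by split=> // i; apply: immersed_sub => //; have [] := FP i.
Qed.

End Immersions.

(** * Routing through a hub *)

Section Linking.
Variable G : digraph.
Implicit Types (u v w : vertex G) (a : diarc G).

(** Picking an arc of [X] on each blocked walk is injective, because the walks share no arc. *)
Lemma card_blocked (J : finType) (P : J -> seq (diarc G)) (X : {set diarc G}) :
  arc_disjoint P -> #|[set j | has (mem X) (P j)]| <= #|X|.
Proof.
move=> D; pose f j := [pick a | (a \in X) && (a \in P j)].
set B := [set _ | _].
have fB j : j \in B -> exists2 a, f j = Some a & (a \in X) && (a \in P j).
  rewrite inE => /hasP[a aP aX]; rewrite /f; case: pickP => [b bX|/(_ a)]; first by exists b.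
  by rewrite aP andbT; rewrite inE in aX; rewrite aX.
rewrite -(card_in_imset (f := f) (D := B)).
  rewrite -(card_imset (mem X) (@Some_inj _)); apply/subset_leq_card/subsetP => _ /imsetP[j jB ->].
  by have [a -> /andP[aX _]] := fB _ jB; apply: imset_f.
move=> i j /fB[a -> /andP[_ ai]] /fB[b -> /andP[_ bj]] [ab].
by apply: D ai _; rewrite ab.
Qed.

(** The length bound allows greedy choices: a chosen link blocks at most three of the walks offered
    to any other pair. *)
Definition linked N u v :=
  exists P : 'I_N -> seq (diarc G),
  [/\ forall i, diwalk u (P i) v, forall i, size (P i) <= 3 & arc_disjoint P].

Lemma linked_set (J : finType) (D : {set J}) (P : J -> seq (diarc G)) N u v :
  N <= #|D| -> {in D, forall j, diwalk u (P j) v && (size (P j) <= 3)} ->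
  {in D &, forall i j a, a \in P i -> a \in P j -> i = j} -> linked N u v.
Proof.
move=> ND W dP; exists (fun i => P (enum_val (widen_ord ND i))); split.
- by move=> i; have /andP[] := W _ (enum_valP (widen_ord ND i)).
- by move=> i; have /andP[] := W _ (enum_valP (widen_ord ND i)).
move=> i j a ai aj; apply/ord_inj.
have := dP _ _ (enum_valP (widen_ord ND i)) (enum_valP (widen_ord ND j)) _ ai aj.
by move/enum_val_inj/(congr1 val).
Qed.

Lemma size_flatten_le (I : Type) (Q : I -> seq (diarc G)) (s : seq I) b :
  all (fun i => size (Q i) <= b) s -> size (flatten (map Q s)) <= b * size s.
Proof.
elim: s => [|i s IHs] //= /andP[Qi /IHs]; rewrite size_cat mulnS; exact: leq_add.
Qed.

(** Greedy induction: the links chosen so far use fewer than [N] arcs, so one of the [N] candidates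
    for the next pair avoids them. *)
Lemma choose_disjoint_links (I : eqType) (s : seq I) (u v : I -> vertex G) N :
  uniq s -> 3 * size s < N -> {in s, forall i, linked N (u i) (v i)} ->
  exists Q : I -> seq (diarc G),
  [/\ {in s, forall i, diwalk (u i) (Q i) (v i)}, all (fun i => size (Q i) <= 3) s
    & {in s &, forall i j a, a \in Q i -> a \in Q j -> i = j}].
Proof.
elim: s => [|i s IHs] /=; first by exists (fun=> [::]).
case/andP=> is_ us Ns L.
have [|||Q [W Z D]] := IHs => //; first by lia.
  by move=> j js; apply: L; rewrite inE js orbT.
have [P [PW PZ PD]] := L i (mem_head _ _).
pose X := [set a in flatten (map Q s)].
have cardX : #|X| <= 3 * size s.
  by rewrite cardsE (leq_trans (card_size _)) // size_flatten_le.
have /existsP[j jX] : [exists j, ~~ has (mem X) (P j)].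
  rewrite -[[exists _, _]]negbK negb_exists; apply/negP => /forallP bl.
  have := card_blocked X PD; rewrite [X in #|pred_of_set X|](_ : _ = setT) ?cardsT ?card_ord; first by lia.
  by apply/setP => x; rewrite !inE; have := bl x; rewrite negbK.
have PQ a l : l \in s -> a \in P j -> a \notin Q l.
  move=> ls /= aP; apply: contra jX => aQ; apply/hasP; exists a => //=.
  rewrite inE; apply/flattenP; exists (Q l) => //; exact: map_f.
have si l : l \in s -> (l == i) = false.
  by move=> ls; apply/negbTE; apply: contra is_ => /eqP <-.
exists (fun l => if l == i then P j else Q l); split.
- move=> l; rewrite inE; case: eqP => [-> _|_ /= /W //]; exact: PW.
- rewrite eqxx PZ /=; apply/allP => l ls; rewrite si //; exact: (allP Z).
- move=> l m; rewrite !inE; case: eqP => [->|_] /=; case: eqP => [->|_] //=.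
  + by move=> _ ms a /(PQ _ _ ms)/negP.
  + by move=> ls _ a al /(PQ _ _ ls); rewrite al.
  + exact: D.
Qed.

Section Hub.
Variables (H : digraph) (k : nat).
Let D : finType := ('I_k * diarc H)%type.

Lemma packed_walks (phi : 'I_k -> vertex H -> vertex G) (P : D -> seq (diarc G)) :
  (forall i, injective (phi i)) ->
  (forall d, diwalk (phi d.1 (src d.2)) (P d) (phi d.1 (tgt d.2))) ->
  arc_disjoint P -> packed H k [set: diarc G].
Proof.
move=> inj W dP; exists (fun i => [set a | [exists e, a \in P (i, e)]]); split.
  move=> i j ij; rewrite -setI_eq0; apply/eqP/setP => a; rewrite !inE.
  apply/negP => /andP[/existsP[e ae] /existsP[f af]].
  by have [/eqP] := dP _ _ _ ae af; rewrite (negbTE ij).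
move=> i; split; first exact: subsetT.
exists (phi i), (fun e => P (i, e)); split=> //.
- by move=> e; apply: (W (i, e)).
- by move=> e a ae; rewrite inE; apply/existsP; exists e.
- by move=> e f a ae af; have [] := dP _ _ _ ae af.
Qed.

(* Route every arc [e] of every copy as [phi (src e) ~> x ~> y ~> phi (tgt e)], choosing the
   short links first, so that they block only boundedly many of the long walks [W]. *)
Lemma packed_hub x y (phi : vertex H -> vertex G) N M (W : 'I_M -> seq (diarc G)) :
  injective phi -> 6 * (k * #|diarc H|) < N -> 7 * (k * #|diarc H|) <= M ->
  (forall z, linked N y (phi z)) -> (forall z, linked N (phi z) x) ->
  (forall i, diwalk x (W i) y) -> arc_disjoint W -> packed H k [set: diarc G].
Proof.
move=> inj NK MK Ly Lx WW WD.
have cardD : #|D| = k * #|diarc H| by rewrite card_prod card_ord.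
pose I : finType := (bool * D)%type.
pose u (i : I) := if i.1 then phi (src i.2.2) else y.
pose v (i : I) := if i.1 then x else phi (tgt i.2.2).
have sizeI : size (enum I) = 2 * #|D| by rewrite -cardE card_prod card_bool.
have [||[[] d] _|Q [QW QZ QD]] := @choose_disjoint_links I (enum I) u v N.
- exact: enum_uniq.
- by rewrite sizeI cardD; lia.
- exact: Lx.
- exact: Ly.
have memI (i : I) : i \in enum I by rewrite mem_enum.
pose X := [set a in flatten (map Q (enum I))].
have cardX : #|X| <= 6 * #|D|.
  rewrite cardsE (leq_trans (card_size _)) //.
  by have := size_flatten_le QZ; rewrite sizeI; lia.
(* The [2 * #|D|] links have at most [6 * #|D|] arcs, so of at least [7 * #|D|] long walks, [#|D|]
   avoid them all. *)
pose B := [set j | has (mem X) (W j)].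
have cardB : #|D| <= #|~: B|.
  by have := cardsC B; have := card_blocked X WD; rewrite -/B card_ord; lia.
pose g (d : D) := enum_val (widen_ord cardB (enum_rank d)).
have g_inj : injective g.
  by move=> d e /enum_val_inj /(congr1 val) /= /ord_inj /enum_rank_inj.
have gX d i a : a \in W (g d) -> a \notin Q i.
  move=> aW; have := enum_valP (widen_ord cardB (enum_rank d)); rewrite !inE.
  apply: contra => aQ; apply/hasP; exists a => //=; rewrite inE.
  by apply/flattenP; exists (Q i) => //; apply: map_f.
apply: (@packed_walks (fun=> phi) (fun d => Q (true, d) ++ W (g d) ++ Q (false, d))) => //.
  move=> d; apply: diwalk_cat (QW (true, d) (memI _)) _.
  exact: diwalk_cat (WW _) (QW (false, d) (memI _)).
move=> d e a; rewrite !mem_cat => /or3P[] ad /or3P[] ae.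
- by have [] := QD _ _ (memI _) (memI _) _ ad ae.
- by have := gX _ _ _ ae => /(_ (true, d)); rewrite ad.
- by have [] := QD _ _ (memI _) (memI _) _ ad ae.
- by have := gX _ _ _ ad => /(_ (true, e)); rewrite ae.
- exact/g_inj/(WD _ _ _ ad ae).
- by have := gX _ _ _ ad => /(_ (false, e)); rewrite ae.
- by have [] := QD _ _ (memI _) (memI _) _ ad ae.
- by have := gX _ _ _ ae => /(_ (false, d)); rewrite ad.
- by have [] := QD _ _ (memI _) (memI _) _ ad ae.
Qed.

Lemma packed_hub1 x (phi : vertex H -> vertex G) N :
  injective phi -> 6 * (k * #|diarc H|) < N ->
  (forall z, linked N x (phi z)) -> (forall z, linked N (phi z) x) ->
  packed H k [set: diarc G].
Proof.
move=> inj NK L1 L2.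
(* Empty walks from [x] to itself are arc-disjoint, so a single hub can play both roles. *)
apply: (@packed_hub x x phi N (7 * (k * #|diarc H|)) (fun=> [::])) => //.
by move=> i /=.
Qed.

(* Every arc can be replaced by parallel ones, a different one for each copy of each arc of [H]. *)
Lemma packed_heavy (A : {set diarc G}) : immersed H A ->
  {in A, forall a, k * #|diarc H| <= #|[set b | (src b == src a) && (tgt b == tgt a)]|} ->
  packed H k [set: diarc G].
Proof.
case=> phi [P [inj W PA PD]] heavy.
have cardD : #|D| = k * #|diarc H| by rewrite card_prod card_ord.
pose cls a := [set b | (src b == src a) && (tgt b == tgt a)].
(* The rank of [d] selects a member of the parallel class of [a]; for [a] in [A] the default of
   [nth] is never reached. *)
pose cp (d : D) a := nth a (enum (cls a)) (enum_rank d).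
have lt_rank (d : D) a : a \in A -> enum_rank d < size (enum (cls a)).
  by move=> /heavy hv; rewrite -cardE; apply: leq_trans hv; rewrite -cardD; exact: ltn_ord.
have cpP d a : a \in A -> cp d a \in cls a.
  by move=> aA; rewrite -mem_enum mem_nth ?lt_rank.
apply: (@packed_walks (fun=> phi) (fun d => map (cp d) (P d.2))) => //.
  move=> d; move: (PA d.2) (W d.2); move: (phi (src _)) (phi (tgt _)) (P _) => u v p.
  elim: p u => [|a p IHp] u pA //= /andP[/eqP srca pv].
  have := cpP d a (pA _ (mem_head _ _)); rewrite inE => /andP[/eqP -> /eqP ->].
  by rewrite srca eqxx IHp // => b bp; rewrite pA // inE bp orbT.
move=> d e _ /mapP[a ad ->] /mapP[b be] E.
have [aA bA] := (PA _ _ ad, PA _ _ be).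
have ab : cls a = cls b.
  have := cpP d a aA; have := cpP e b bA; rewrite -E !inE => /andP[/eqP s1 /eqP t1] /andP[/eqP s2 /eqP t2].
  by apply/setP => c; rewrite !inE -s1 -t1 s2 t2.
apply/enum_rank_inj/ord_inj/eqP.
rewrite -(nth_uniq a (lt_rank d a aA) _ (enum_uniq (mem (cls a)))); last first.
  by rewrite ab lt_rank.
apply/eqP; rewrite [LHS]E /cp -ab; apply: set_nth_default.
by rewrite ab lt_rank.
Qed.

End Hub.
End Linking.

(** * Menger's theorem for arc-disjoint walks *)

Section Menger.
Variable G : digraph.
Implicit Types (u v w x y : vertex G) (a : diarc G) (F : {set diarc G}).
Local Open Scope ring_scope.
Import GRing.Theory.

Definition unit_at (u v : vertex G) : int := (u == v)%:R.

(** Net out-degree at [v], with arc sets viewed as 0-1 flows. *)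
Definition net F v : int := \sum_(a in F) (unit_at (src a) v - unit_at (tgt a) v).

Definition in_arcs (Z : {set vertex G}) : {set diarc G} :=
  [set a | (src a \notin Z) && (tgt a \in Z)].

Lemma sum_unit_at u (Z : {set vertex G}) : \sum_(v in Z) unit_at u v = (u \in Z)%:R.
Proof.
have [uZ|uZ] := boolP (u \in Z).
  rewrite (bigD1 u) //= big1 /unit_at ?eqxx ?addr0 // => v /andP[_ /negbTE].
  by rewrite eq_sym => ->.
rewrite big1 // => v vZ; rewrite /unit_at; case: eqP => // uv.
by rewrite uv vZ in uZ.
Qed.

Lemma sum_net F (Z : {set vertex G}) :
  \sum_(v in Z) net F v = #|F :&: in_arcs (~: Z)|%:R - #|F :&: in_arcs Z|%:R.
Proof.
rewrite exchange_big /=.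
under eq_bigr => a _ do rewrite sumrB !sum_unit_at.
have card1 (B : {set diarc G}) : #|F :&: B|%:R = \sum_(a in F) (a \in B)%:R :> int.
  rewrite -sum1_card natr_sum [RHS](bigID (mem B)) /= [X in _ + X]big1 ?addr0.
    by rewrite (eq_bigl (fun a => (a \in F) && (a \in B))) => [|a];
      [apply: eq_bigr => a /andP[_ ->] | rewrite inE].
  by move=> a /andP[_ /negbTE ->].
rewrite !card1 -sumrB; apply: eq_bigr => a aF; rewrite !inE !negbK.
by case: (src a \in Z); case: (tgt a \in Z).
Qed.

Definition flow x y (m : nat) F := forall v, net F v = unit_at x v *+ m - unit_at y v *+ m.

Lemma net_add F a v : a \notin F ->
  net (a |: F) v = unit_at (src a) v - unit_at (tgt a) v + net F v.
Proof. by move=> aF; rewrite /net big_setU1. Qed.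

Lemma net_rem F a v : a \in F ->
  net (F :\ a) v = net F v - (unit_at (src a) v - unit_at (tgt a) v).
Proof. by move=> aF; rewrite /net (big_setD1 a aF) /= addrC addrK. Qed.

Definition residual F : rel (vertex G) := fun u v =>
  [exists a, (a \notin F) && (src a == u) && (tgt a == v)
          || (a \in F) && (src a == v) && (tgt a == u)].

(** Arcs are toggled along the path. The second clause carries the induction: as [u] is off the rest
    of the path, toggling that rest does not affect the first arc. *)
Lemma flip_residual_path F u p : path (residual F) u p -> uniq (u :: p) ->
  exists F', (forall v, net F' v = net F v + unit_at u v - unit_at (last u p) v) /\
    (forall a, (src a \notin u :: p) || (tgt a \notin u :: p) -> (a \in F') = (a \in F)).
Proof.
elim: p u => [|w p IHp] u; first by exists F; split=> // v; rewrite /= addrK.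
rewrite /= => /andP[/existsP[a ra] pth] /andP[unot up].
have [F' [netF' F'F]] := IHp w pth up.
have aF' : (a \in F') = (a \in F).
  apply: F'F; case/orP: ra => /andP[/andP[_ /eqP s] /eqP t];
  by rewrite ?s ?t unot ?orbT.
have keep b : (src b \notin u :: w :: p) || (tgt b \notin u :: w :: p) ->
    (b != a) /\ (b \in F') = (b \in F).
  move=> bnot; split; last first.
    by apply: F'F; case/orP: bnot; rewrite inE negb_or => /andP[_ ->]; rewrite ?orbT.
  apply: contraL bnot => /eqP ->; rewrite negb_or !negbK.
  case/orP: ra => /andP[/andP[_ /eqP s] /eqP t]; by rewrite s t !inE !eqxx ?orbT.
case/orP: ra => /andP[/andP[aF /eqP s] /eqP t].
- exists (a |: F'); split=> [v|b /keep[ba bF]]; last by rewrite !inE (negbTE ba).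
  rewrite net_add ?aF' // netF' s t; lia.
- exists (F' :\ a); split=> [v|b /keep[ba bF]]; last by rewrite !inE ba.
  rewrite net_rem ?aF' // netF' s t; lia.
Qed.

(** Without an augmenting path, [F] contains every arc leaving the residually reachable set [Y] and
    none entering it, so the net outflow [m] of [Y] is the size of the cut. *)
Lemma flow_augment x y m F : flow x y m F ->
  (exists F', flow x y m.+1 F') \/
  exists Z : {set vertex G}, [/\ y \in Z, x \notin Z & (#|in_arcs Z| <= m)%N].
Proof.
move=> fF; have [/connectP[p0 p0P ylast]|xy] := boolP (connect (residual F) x y).
  left; case/shortenP: p0P ylast => p pP up _ ylast.
  have [F' [netF' _]] := flip_residual_path pP up; exists F' => v.
  rewrite netF' fF -ylast !mulrS; lia.
right; pose Y := [set v | connect (residual F) x v]; exists (~: Y).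
have xY : x \in Y by rewrite inE connect0.
split; rewrite ?inE ?connect0 //.
have step u v : u \in Y -> residual F u v -> v \in Y.
  by rewrite !inE => xu uv; apply: connect_trans xu (connect1 uv).
have := sum_net F Y.
under eq_bigr => v _ do rewrite fF.
rewrite sumrB !sumrMnl !sum_unit_at xY inE (negbTE xy) mul0rn subr0.
have -> : F :&: in_arcs Y = set0.
  apply/setP => a; rewrite in_setI in_set0 [a \in in_arcs _]inE.
  apply/negP => /and3P[aF /negP sY tY]; apply: sY; apply: step tY _.
  by apply/existsP; exists a; rewrite aF !eqxx orbT.
have -> : F :&: in_arcs (~: Y) = in_arcs (~: Y).
  apply/setIidPr/subsetP => a; rewrite !inE negbK => /andP[sY tY].
  apply: contraNT tY => aF; have := step (src a) (tgt a); rewrite !inE; apply=> //.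
  by apply/existsP; exists a; rewrite aF !eqxx.
rewrite cards0; lia.
Qed.

Lemma connect_diwalk F x y :
  connect (fun u v => [exists a, (a \in F) && (src a == u) && (tgt a == v)]) x y ->
  exists2 q, diwalk x q y & {subset q <= F}.
Proof.
case/connectP=> p; elim: p x => [|w p IHp] x /=; first by move=> _ ->; exists [::] => /=.
case/andP=> /existsP[a /andP[/andP[aF /eqP s] /eqP t]] /IHp{}IHp /IHp[q qW qF].
exists (a :: q); first by rewrite /= s t eqxx.
by move=> b; rewrite inE => /predU1P[->|/qF].
Qed.

Lemma net_dipath x q y : dipath x q y ->
  forall v, net [set a in q] v = unit_at x v - unit_at y v.
Proof.
elim: q x => [|a q IHq] x.
  rewrite /dipath /= => /andP[/eqP -> _] v.
  by rewrite subrr /net big1 // => a; rewrite inE.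
rewrite /dipath /= => /andP[/andP[/eqP s W] /andP[xq u]] v.
have qa : a \notin q.
  by apply: contra xq => /(src_walk_vertices W); rewrite s.
rewrite set_cons net_add ?inE // (IHq (tgt a)) ?s; last by rewrite /dipath W.
lia.
Qed.

(** Paths inside [F] are peeled off one at a time, each lowering the value of the flow by one. *)
Lemma flow_walks x y m F : x != y -> flow x y m F ->
  exists P : nat -> seq (diarc G), [/\ forall i, (i < m)%N -> diwalk x (P i) y,
    forall i, (i < m)%N -> {subset P i <= F}
    & forall i j a, (i < m)%N -> (j < m)%N -> a \in P i -> a \in P j -> i = j].
Proof.
move=> xy; elim: m F => [|m IHm] F fF; first by exists (fun=> [::]); split.
pose e u v := [exists a, (a \in F) && (src a == u) && (tgt a == v)].
have /connect_diwalk[q0 q0W q0F] : connect e x y.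
  (* Otherwise no arc of [F] leaves the set [Y] reachable along [F], whose net outflow is [m.+1]. *)
  apply/negPn/negP => nxy; pose Y := [set v | connect e x v].
  have := sum_net F Y.
  under eq_bigr => v _ do rewrite fF.
  rewrite sumrB !sumrMnl !sum_unit_at !inE connect0 (negbTE nxy) mul0rn subr0.
  have -> : F :&: in_arcs (~: Y) = set0.
    apply/setP => a; rewrite !inE negbK; apply/negP => /and3P[aF sY /negP[]].
    apply: connect_trans sY (connect1 _).
    by apply/existsP; exists a; rewrite aF !eqxx.
  rewrite cards0; lia.
have [q qP qq0] := diwalk_shorten q0W.
have qF : {subset q <= F} by move=> a /qq0/q0F.
pose F' := F :\: [set a in q].
have fF' : flow x y m F'.
  move=> v; have : net F v = net [set a in q] v + net F' v.
    rewrite /net (big_setID [set a in q]) /=; congr (_ + _).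
    by apply: eq_bigl => a; rewrite !inE; case aq: (a \in q); rewrite ?andbF ?andbT //; apply: qF.
  rewrite fF (net_dipath qP) !mulrS; lia.
have [P [PW PF PD]] := IHm F' fF'.
have Pq i a : (i < m)%N -> a \in P i -> a \notin q.
  by move=> im /(PF _ im); rewrite !inE => /andP[].
exists (fun i => if i is j.+1 then P j else q); split.
- by case=> [|i] //= im; [have /andP[] := qP | apply: PW].
- by case=> [|i] //= im a /(PF _ im); rewrite inE => /andP[].
- case=> [|i] [|j] a //= im jm.
  + by move=> aq /(Pq _ _ jm); rewrite aq.
  + by move=> /(Pq _ _ im)/negP.
  + by move=> ai aj; rewrite (PD i j a).
Qed.

Lemma menger x y m : x != y ->
  (exists W : 'I_m -> seq (diarc G), (forall i, diwalk x (W i) y) /\ arc_disjoint W) \/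
  exists Z : {set vertex G}, [/\ y \in Z, x \notin Z & (#|in_arcs Z| <= m)%N].
Proof.
move=> xy.
have : (exists F, flow x y m F) \/
    exists Z : {set vertex G}, [/\ y \in Z, x \notin Z & (#|in_arcs Z| <= m)%N].
  elim: m => [|m [[F fF]|[Z [yZ xZ Zm]]]].
  - by left; exists set0 => v; rewrite /net big_set0 !mulr0n subr0.
  - have [fl|[Z [yZ xZ Zm]]] := flow_augment fF; first by left.
    by right; exists Z; split=> //; apply: leqW.
  - by right; exists Z; split=> //; apply: leqW.
case=> [[F fF]|]; last by right.
have [P [PW _ PD]] := flow_walks xy fF.
left; exists (fun i => P i); split=> [i|i j a ai aj]; first exact: PW.
by apply/ord_inj; apply: PD ai aj.
Qed.

End Menger.

(** * Semicomplete digraphs *)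

Section FiniteSets.

(** Double counting inside the set [S] of low vertices: by totality its [r * r.-1] ordered pairs are
    at most twice the number of related pairs, which is at most [r * q.-1]. *)
Lemma card_low_outdegree (V : finType) (T : rel V) (D : {set V}) q :
  {in D &, forall u v, u != v -> T u v || T v u} ->
  #|[set v in D | #|[set w in D | T v w]| < q]| <= 2 * q.
Proof.
move=> tot; set S := [set _ in _ | _]; set r := #|S|.
have SD v : v \in S -> v \in D by rewrite inE => /andP[].
have cardT v : v \in S -> \sum_(w in S) (T v w : nat) <= q.-1.
  move=> vS; move: (vS); rewrite inE => /andP[vD vq].
  suff: \sum_(w in S) (T v w : nat) <= #|[set w in D | T v w]| by lia.
  rewrite -sum1_card big_mkcond [leqRHS]big_mkcond /=.
  apply: leq_sum => w _; case: ifP => // /SD wD; rewrite inE wD /=.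
  by case: (T v w).
have outer : \sum_(v in S) \sum_(w in S) (T v w : nat) <= r * q.-1.
  by rewrite -sum_nat_const; apply: leq_sum => v /cardT.
have pairs : \sum_(v in S) \sum_(w in S) (v != w : nat) = r * r.-1.
  rewrite -sum_nat_const; apply: eq_bigr => v vS.
  rewrite (bigD1 v) //= eqxx /= add0n.
  rewrite (eq_bigr (fun=> 1)) => [|w /andP[_]]; last by rewrite eq_sym => ->.
  rewrite sum1_card /r (cardsD1 v S) vS /=; apply: eq_card => w.
  by rewrite in_setD1 andbC.
have le : \sum_(v in S) \sum_(w in S) (v != w : nat) <=
    \sum_(v in S) \sum_(w in S) (T v w : nat) + \sum_(v in S) \sum_(w in S) (T v w : nat).
  rewrite [X in _ <= _ + X]exchange_big /= -big_split /=; apply: leq_sum => v vS.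
  rewrite -big_split /=; apply: leq_sum => w wS.
  by case vw: (v != w) => //; have := tot _ _ (SD _ vS) (SD _ wS) vw; case: (T v w); case: (T w v).
have [->//|r0] := posnP r.
have q0 : 0 < q.
  by case/card_gt0P: r0 => v; rewrite inE => /andP[_]; apply: leq_trans.
suff : r.-1 <= 2 * q.-1 by lia.
rewrite -(leq_pmul2l r0) -pairs (leq_trans le) // mulnCA mul2n -addnn leq_add //.
Qed.

Lemma injection_into (U V : finType) (S : {set V}) :
  #|U| <= #|S| -> exists2 phi : U -> V, injective phi & forall z, phi z \in S.
Proof.
move=> US; exists (fun z => enum_val (widen_ord US (enum_rank z))).
  by move=> y z /enum_val_inj /(congr1 val) /= /ord_inj /enum_rank_inj.
by move=> z; apply: enum_valP.
Qed.

Lemma card_bigcup_leq (I T : finType) (A : {set I}) (B : I -> {set T}) m :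
  {in A, forall i, #|B i| <= m} -> #|\bigcup_(i in A) B i| <= #|A| * m.
Proof.
move=> Bm; rewrite -sum_nat_const.
elim/big_rec2: _ => [|i y Z iA Zy]; first by rewrite cards0.
by rewrite (leq_trans (leq_card_setU _ _)) // leq_add // Bm.
Qed.

Lemma decreasing_order (V : finType) (d : V -> nat) : exists pos : V -> nat,
  [/\ forall v, pos v < #|V|,
      forall u v, pos u < pos v -> d v <= d u
    & forall i j, j <= #|V| -> #|[set v | i <= pos v < j]| = j - i].
Proof.
pose s := sort (fun u v => d v <= d u) (enum V).
have us : uniq s by rewrite sort_uniq enum_uniq.
have mems v : v \in s by rewrite mem_sort mem_enum.
have sizes : size s = #|V| by rewrite size_sort -cardE.
exists (index^~ s); split.
- by move=> v; rewrite -sizes index_mem.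
- move=> u v; apply: (sorted_ltn_index (leT := fun u v => d v <= d u)) => //.
    by move=> y x z yx zy; apply: leq_trans zy yx.
  by apply: sort_sorted => x y; apply: leq_total.
move=> i j jV; apply/eqP; rewrite eqn_leq; apply/andP; split.
  rewrite cardE -(size_map (index^~ s)) -(size_iota i (j - i)); apply: uniq_leq_size.
    rewrite map_inj_in_uniq ?enum_uniq // => u v _ _ uv.
    by rewrite -(nth_index u (mems u)) uv nth_index.
  move=> _ /mapP[v + ->]; rewrite mem_enum inE mem_iota; lia.
have -> : j - i = size (take (j - i) (drop i s)).
  by rewrite size_take size_drop sizes; case: ifP; lia.
rewrite cardE; apply: uniq_leq_size; first by rewrite take_uniq ?drop_uniq.
move=> v vt; have := vt => /(nthP v)[l]; rewrite size_take size_drop sizes => lt.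
have {lt} ltj : l < j - i by move: lt; case: ifP; lia.
rewrite nth_take // nth_drop => <-; rewrite mem_enum inE index_uniq ?sizes //; lia.
Qed.

End FiniteSets.

Section Semicomplete.
Variable G : digraph.
Hypothesis sG : semicomplete G.
Implicit Types (u v w x y : vertex G) (a : diarc G).

Definition adj u v := [exists a : diarc G, (src a == u) && (tgt a == v)].

Lemma adj_neq u v : adj u v -> u != v.
Proof. by case/existsP=> a /andP[/eqP <- /eqP <-]; apply: loopless. Qed.

Lemma adj_total u v : u != v -> adj u v || adj v u.
Proof.
move=> /sG[a [[s t]|[s t]]]; apply/orP; [left|right]; apply/existsP; exists a;
by rewrite s t !eqxx.
Qed.

Definition step u v : seq (diarc G) :=
  if [pick a | (src a == u) && (tgt a == v)] is Some a then [:: a] else [::].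

Lemma mem_step u v a : a \in step u v -> src a = u /\ tgt a = v.
Proof.
rewrite /step; case: pickP => // b /andP[/eqP s /eqP t].
by rewrite inE => /eqP ->.
Qed.

Lemma diwalk_step u v : adj u v -> diwalk u (step u v) v.
Proof.
rewrite /step => /existsP[a ae]; case: pickP => [b|/(_ a)]; last by rewrite ae.
by rewrite /= => /andP[-> ->].
Qed.

Lemma size_step u v : size (step u v) <= 1.
Proof. by rewrite /step; case: pickP. Qed.

(** Every arc used has its midpoint [w] as an end, and [u] is never a midpoint, so walks through
    different midpoints share no arc. *)
Lemma linked2 N (D : {set vertex G}) u v : N <= #|D| ->
  {in D, forall w, adj u w && adj w v} -> linked N u v.
Proof.
move=> ND DP; apply: (@linked_set _ _ D (fun w => step u w ++ step w v)) => //.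
  move=> w /DP/andP[uw wv]; rewrite size_cat.
  rewrite (diwalk_cat (diwalk_step uw) (diwalk_step wv)) /=.
  by have := size_step u w; have := size_step w v; lia.
move=> w w' /DP/andP[/adj_neq uw _] /DP/andP[/adj_neq uw' _] a.
rewrite !mem_cat => /orP[]/mem_step[s t] /orP[]/mem_step[s' t'].
- by rewrite -t.
- by move: uw'; rewrite -s -s' eqxx.
- by move: uw; rewrite -s -s' eqxx.
- by rewrite -s.
Qed.

(** The three arcs of a walk leave [L], enter [L] and stay inside [L], so a common arc has the same
    place in both walks, and there it determines [w]. *)
Lemma linked3 N (D L : {set vertex G}) (b : vertex G -> vertex G) u v : N <= #|D| ->
  {in D, forall w, [&& adj u (b w), adj (b w) w & adj w v]} ->
  {in D &, injective b} -> u \in L -> v \in L ->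
  {in D, forall w, (w \in L) && (b w \notin L)} -> linked N u v.
Proof.
move=> ND DP binj uL vL DL.
apply: (@linked_set _ _ D (fun w => step u (b w) ++ step (b w) w ++ step w v)) => //.
  move=> w /DP/and3P[uw bw wv]; rewrite !size_cat.
  rewrite (diwalk_cat (diwalk_step uw) (diwalk_cat (diwalk_step bw) (diwalk_step wv))) /=.
  by have := size_step u (b w); have := size_step (b w) w; have := size_step w v; lia.
move=> w w' wD w'D a.
have [/andP[wL bL] /andP[wL' bL']] := (DL _ wD, DL _ w'D).
rewrite !mem_cat => /or3P[]/mem_step[s t] /or3P[]/mem_step[s' t'].
- by apply: binj => //; rewrite -t -t'.
- by move: bL'; rewrite -s' s uL.
- by move: bL; rewrite -t t' vL.
- by move: bL; rewrite -s s' uL.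
- by rewrite -t -t'.
- by move: bL; rewrite -s s' wL'.
- by move: bL'; rewrite -t' t vL.
- by move: bL'; rewrite -s' s wL.
- by rewrite -s -s'.
Qed.

(* A spanning tournament: opposite pairs of arcs are resolved by [enum_rank]. *)
Definition dominates : rel (vertex G) := fun u v =>
  adj u v && (~~ adj v u || (enum_rank u < enum_rank v)).

Lemma dominates_adj u v : dominates u v -> adj u v.
Proof. by case/andP. Qed.

Lemma dominates_total u v : u != v -> dominates u v || dominates v u.
Proof.
move=> uv; rewrite /dominates; have := adj_total uv.
case: (adj u v); case: (adj v u) => //= _.
by rewrite -neq_ltn; apply: contra uv => /eqP/ord_inj/enum_rank_inj ->.
Qed.

Lemma dominates_asym u v : dominates u v -> ~~ dominates v u.
Proof.
rewrite /dominates; case: (adj u v); case: (adj v u) => //= uv.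
by rewrite -leqNgt ltnW.
Qed.

End Semicomplete.

(** * Cuts of the out-degree ordering *)

Section Ordering.
Variables (G H : digraph) (k : nat).
Hypothesis sG : semicomplete G.
Hypothesis H0 : 0 < #|vertex H|.
Hypothesis npacked : ~ packed H k [set: diarc G].
Implicit Types u v w x y : vertex G.

Let K := k * #|diarc H|.
Let h := #|vertex H|.
(** The least number of links that [packed_hub] accepts. *)
Let N := (6 * K).+1.
Let T := @dominates G.

Let T_total (D : {set vertex G}) : {in D &, forall u v, u != v -> T u v || T v u}.
Proof. by move=> u v _ _; apply: dominates_total. Qed.

Let T_totalC (D : {set vertex G}) :
  {in D &, forall u v, u != v -> T v u || T u v}.
Proof. by move=> u v _ _; rewrite orbC; apply: dominates_total. Qed.

Lemma card_high_outdegree (D : {set vertex G}) q :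
  #|D| <= #|[set v in D | q <= #|[set w in D | T v w]|]| + 2 * q.
Proof.
have := card_low_outdegree q (@T_total D); set B := [set _ in _ | _] => Bq.
rewrite -(cardsID B D) addnC leq_add //; last first.
  by rewrite (leq_trans _ Bq) // subset_leq_card // subsetIr.
apply/subset_leq_card/subsetP => v; rewrite in_setD => /andP[+ vD].
by rewrite !inE vD /= -leqNgt.
Qed.

Lemma card_high_indegree (D : {set vertex G}) q :
  #|D| <= #|[set v in D | q <= #|[set w in D | T w v]|]| + 2 * q.
Proof.
have := @card_low_outdegree _ (fun u v => T v u) D q (@T_totalC D).
set B := [set _ in _ | _] => Bq.
rewrite -(cardsID B D) addnC leq_add //; last first.
  by rewrite (leq_trans _ Bq) // subset_leq_card // subsetIr.
apply/subset_leq_card/subsetP => v; rewrite in_setD => /andP[+ vD].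
by rewrite !inE vD /= -leqNgt.
Qed.

Lemma no_hub (U : {set vertex G}) x : h <= #|U| ->
  {in U, forall u, linked N x u} -> {in U, forall u, linked N u x} -> False.
Proof.
move=> /injection_into[phi inj phiU] L1 L2; apply: npacked.
by apply: (@packed_hub1 G H k x phi N) => // z; [apply: L1|apply: L2].
Qed.

(** Two-step walks through [D] link [y] to, and to [x] from, each vertex of large in- and out-degree
    within [D]. Each degree condition excludes at most [2 * N] vertices, so [h] remain for the
    vertices of [H]. *)
Lemma no_poles (D : {set vertex G}) x y (W : 'I_(7 * K) -> seq (diarc G)) :
  4 * N + h <= #|D| -> {in D, forall m, adj y m && adj m x} ->
  (forall i, diwalk x (W i) y) -> arc_disjoint W -> False.
Proof.
move=> cardD DP WW WD; apply: npacked.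
pose U1 := [set v in D | N <= #|[set w in D | T v w]|].
pose U2 := [set v in D | N <= #|[set w in D | T w v]|].
have [phi inj phiU] : exists2 phi : vertex H -> vertex G,
    injective phi & forall z, phi z \in U1 :&: U2.
  apply: injection_into.
  have c1 : #|D| <= #|U1| + 2 * N := card_high_outdegree D N.
  have c2 : #|D| <= #|U2| + 2 * N := card_high_indegree D N.
  have := cardsUI U1 U2.
  have : #|U1 :|: U2| <= #|D|.
    by apply/subset_leq_card/subsetP => v; rewrite !inE => /orP[]/andP[].
  rewrite -/h; lia.
apply: (@packed_hub G H k x y phi N (7 * K) W) => // z;
  have := phiU z; rewrite !inE => /andP[/andP[_ out] /andP[_ inn]].
- apply: (linked2 inn) => w; rewrite inE => /andP[/DP/andP[-> _]].
  exact: dominates_adj.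
- apply: (linked2 out) => w; rewrite inE => /andP[/DP/andP[_ ->]].
  by rewrite andbT; apply: dominates_adj.
Qed.

Lemma no_pole (D : {set vertex G}) x :
  {in D, forall m, adj x m && adj m x} -> #|D| < 4 * N + h.
Proof.
move=> DP; rewrite ltnNge; apply/negP => cardD.
by apply: (@no_poles D x x (fun=> [::])) => // i /=.
Qed.

Variable pos : vertex G -> nat.
Hypotheses (pos_lt : forall v, pos v < #|vertex G|)
  (pos_dec : forall u v, pos u < pos v ->
     #|[set w | dominates v w]| <= #|[set w | dominates u w]|)
  (pos_card : forall i j, j <= #|vertex G| -> #|[set v | i <= pos v < j]| = j - i).

Let s := 2 * (4 * N + h).

Lemma dominates_diff u v w : T u v -> T v w -> ~~ T u w -> adj w u.
Proof.
move=> uv vw uw; apply: (@dominates_adj G).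
have wu : w != u by apply: contraTN vw => /eqP ->; apply: dominates_asym.
by have := dominates_total sG wu; rewrite -/T (negbTE uw) orbF.
Qed.

(** The out-degree of [u] is at least that of [v], so [u] dominates at least as many vertices beyond
    those of [v] as conversely. *)
Lemma card_outdiff (E : {set vertex G}) u v : pos u < pos v ->
  {in E, forall w, T v w && ~~ T u w} -> #|E| <= #|[set w | T u w && ~~ T v w]|.
Proof.
move=> /pos_dec le EP.
have -> : [set w | T u w && ~~ T v w] = [set w | T u w] :\: [set w | T v w].
  by apply/setP => w; rewrite !inE andbC.
have : E \subset [set w | T v w] :\: [set w | T u w].
  by apply/subsetP => w /EP; rewrite !inE andbC.
move=> /subset_leq_card; rewrite !cardsD setIC; rewrite -/T in le; lia.
Qed.

(* Back neighbours [m] joined to [y] in both directions make [y] a pole. For the others,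
   comparing out-degrees turns the many 2-step walks from [m] to [y] through back neighbours
   into as many 2-step walks from [y] to [m]. *)
Lemma card_back_in y : #|[set m | (pos y < pos m) && adj m y]| <= s.
Proof.
set S := [set _ | _]; pose D := [set m in S | T y m]; pose E := [set m in S | T m y].
have SDE : S \subset D :|: E.
  apply/subsetP => m mS; apply/setUP.
  have ne : y != m by move: mS; rewrite inE eq_sym => /andP[_ /adj_neq].
  by case/orP: (dominates_total sG ne) => Tm; [left|right]; apply/setIdP.
have Dlt : #|D| < 4 * N + h.
  by apply: (@no_pole D y) => m; rewrite !inE => /andP[/andP[_ ->]] /dominates_adj ->.
suff Elt : #|E| < 2 * N + h.
  by have := leq_trans (subset_leq_card SDE) (leq_card_setU D E); rewrite /s; lia.
rewrite ltnNge; apply/negP => cardE.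
pose U := [set v in E | N <= #|[set w in E | T v w]|].
have EP w : w \in E -> [/\ pos y < pos w, adj w y & T w y].
  by rewrite !inE => /andP[/andP[]].
apply: (@no_hub U y) => [|v|v].
- by have := card_high_outdegree E N; rewrite -/U; lia.
- rewrite inE => /andP[/EP[yv _ Tvy] Nv].
  have Nle : N <= #|[set w | T y w && ~~ T v w]|.
    apply: leq_trans Nv (card_outdiff yv _) => w; rewrite inE => /andP[/EP[_ _ wy] ->] /=.
    exact: dominates_asym.
  apply: (linked2 Nle) => w; rewrite inE => /andP[yw vw].
  by rewrite (dominates_adj yw) (dominates_diff Tvy).
- rewrite inE => /andP[_ Nv]; apply: (linked2 Nv) => w; rewrite inE => /andP[/EP[_ wy _] vw].
  by rewrite wy (dominates_adj vw).
Qed.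

(** The mirror image of [card_back_in]: the two-step walks inside [E] lead from [x] to [v], and
    comparing out-degrees yields those from [v] to [x]. *)
Lemma card_back_out x : #|[set m | (pos m < pos x) && adj x m]| <= s.
Proof.
set S := [set _ | _]; pose D := [set m in S | T m x]; pose E := [set m in S | T x m].
have SDE : S \subset D :|: E.
  apply/subsetP => m mS; apply/setUP.
  have ne : m != x by move: mS; rewrite inE eq_sym => /andP[_ /adj_neq].
  by case/orP: (dominates_total sG ne) => Tm; [left|right]; apply/setIdP.
have Dlt : #|D| < 4 * N + h.
  by apply: (@no_pole D x) => m; rewrite !inE => /andP[/andP[_ ->]] /dominates_adj ->.
suff Elt : #|E| < 2 * N + h.
  by have := leq_trans (subset_leq_card SDE) (leq_card_setU D E); rewrite /s; lia.
rewrite ltnNge; apply/negP => cardE.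
pose U := [set v in E | N <= #|[set w in E | T w v]|].
have EP w : w \in E -> [/\ pos w < pos x, adj x w & T x w].
  by rewrite !inE => /andP[/andP[]].
apply: (@no_hub U x) => [|v|v].
- by have := card_high_indegree E N; rewrite -/U; lia.
- rewrite inE => /andP[_ Nv]; apply: (linked2 Nv) => w; rewrite inE => /andP[/EP[_ xw _] wv].
  by rewrite xw (dominates_adj wv).
- rewrite inE => /andP[/EP[vx _ Txv] Nv].
  have Nle : N <= #|[set w | T v w && ~~ T x w]|.
    apply: leq_trans Nv (card_outdiff vx _) => w; rewrite inE => /andP[/EP[_ _ ->]] /=.
    exact: dominates_asym.
  apply: (linked2 Nle) => w; rewrite inE => /andP[vw xw].
  by rewrite (dominates_adj vw) (dominates_diff Txv).
Qed.

Definition heads i := [set v | (pos v < i) && [exists b, (i <= pos b) && adj b v]].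
Definition tails j := [set v | (j <= pos v) && [exists b, (pos b < j) && adj v b]].

(** Fewer than [2 * (N + s) + h] vertices suffice as sources of backward arcs to all heads, and each
    serves at most [s] heads. *)
Let c := s * (2 * (N + s) + h).

(* Many heads give a large matching of backward arcs [b w -> w]. Since [u] sends arcs to almost
   all [b w], the walks [u -> b w -> w -> v] link any two heads of large in-degree. *)
Lemma card_heads i : #|heads i| <= c.
Proof.
pose b v := odflt v [pick w | (i <= pos w) && adj w v].
have bP v : v \in heads i -> [/\ pos v < i, i <= pos (b v) & adj (b v) v].
  rewrite inE => /andP[vi /existsP[w wP]]; rewrite /b; case: pickP => [w' /andP[]|/(_ w)] //.
  by rewrite wP.
pose B := b @: heads i.
have le1 : #|heads i| <= #|B| * s.
  rewrite -sum1_card (partition_big_imset b) /= -sum_nat_const; apply: leq_sum => y _.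
  rewrite sum1_card (leq_trans _ (card_back_out y)) //; apply/subset_leq_card/subsetP => m.
  rewrite unfold_in => /andP[/bP[mi ib bm] /eqP <-]; rewrite inE bm andbT; exact: leq_trans mi ib.
suff Blt : #|B| < 2 * (N + s) + h.
  by rewrite (leq_trans le1) // mulnC leq_mul2l ltnW ?orbT.
rewrite ltnNge; apply/negP => cardB.
(* One head is kept for each source, which makes [b] injective on [A]. *)
pose g y := odflt y [pick v in heads i | b v == y].
have gP y : y \in B -> g y \in heads i /\ b (g y) = y.
  move=> /imsetP[v vi ->]; rewrite /g; case: pickP => [w /andP[wi /eqP]|/(_ v)] //.
  by rewrite /= vi eqxx.
pose A := g @: B.
have cardA : #|A| = #|B|.
  by apply: card_in_imset => y z /gP[_ E] /gP[_ E'] yz; rewrite -E -E' yz.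
have AP v : v \in A -> [/\ pos v < i, i <= pos (b v) & adj (b v) v].
  by move=> /imsetP[y /gP[gy _] ->]; apply: bP.
have b_inj : {in A &, injective b}.
  by move=> _ _ /imsetP[y /gP[_ by_] ->] /imsetP[z /gP[_ bz] ->]; rewrite by_ bz => ->.
pose U := [set v in A | N + s <= #|[set w in A | T w v]|].
have cardU : h <= #|U|.
  by have := card_high_indegree A (N + s); rewrite -/U; lia.
have link : {in U &, forall u v, linked N u v}.
  move=> u v; rewrite inE => /andP[/AP[ui _ _] _]; rewrite inE => /andP[/AP[vi _ _] vN].
  (* If [u] has no arc to the later vertex [b w], then [b w] is one of its at most [s] back
     neighbours; this is the reason for the surplus [s] in [U]. *)
  pose F := [set w in A | ~~ adj u (b w)].
  have Fs : #|F| <= s.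
    rewrite -(card_in_imset (f := b) (D := F)); last first.
      by move=> w w'; rewrite !inE => /andP[wA _] /andP[w'A _]; apply: b_inj.
    apply: leq_trans (card_back_in u); apply/subset_leq_card/subsetP => _ /imsetP[w + ->].
    rewrite !inE => /andP[/AP[wi iw bw] nadj].
    have lt : pos u < pos (b w) by apply: leq_trans ui iw.
    have ne : u != b w by apply: contraTneq lt => ->; rewrite ltnn.
    by rewrite lt /=; have := adj_total sG ne; rewrite (negbTE nadj).
  apply: (@linked3 G N ([set w in A | T w v] :\: F) [set w | pos w < i] b) => //.
  - by rewrite cardsD; have := subset_leq_card (subsetIr [set w in A | T w v] F); lia.
  - move=> w; rewrite !inE => /andP[+ /andP[wA wv]]; rewrite wA negbK => /= ->.
    by have [_ _ ->] := AP _ wA; rewrite (dominates_adj wv).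
  - move=> w w'; rewrite !inE => /andP[_ /andP[wA _]] /andP[_ /andP[w'A _]].
    exact: b_inj.
  - by rewrite inE.
  - by rewrite inE.
  - move=> w; rewrite !inE => /andP[_ /andP[/AP[-> iw _] _]].
    by rewrite -leqNgt.
have /card_gt0P[z zU] : 0 < #|U| by apply: leq_trans cardU.
by apply: (@no_hub U z) => // u uU; apply: link.
Qed.

(** Every tail is a back neighbour of some head, and a head has at most [s] of those. *)
Lemma card_tails j : #|tails j| <= c * s.
Proof.
apply: leq_trans (_ : #|heads j| * s <= _); last by rewrite leq_mul2r card_heads orbT.
apply: leq_trans (card_bigcup_leq (A := heads j)
  (B := fun y => [set m | (pos y < pos m) && adj m y]) _); last first.
  by move=> y _; apply: card_back_in.
apply/subset_leq_card/subsetP => v; rewrite inE => /andP[jv /existsP[w /andP[wj vw]]].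
apply/bigcupP; exists w; first by rewrite inE wj; apply/existsP; exists v; rewrite jv.
by rewrite inE vw andbT; apply: leq_trans wj jv.
Qed.

(** Strictly between positions at distance [L] there remain [4 * N + h] vertices, as [no_poles]
    requires, after [2 * s] back neighbours are discarded. *)
Let L := (4 * N + h + 2 * s).+1.

(** Intermediate vertices that are back neighbours of neither end give two-step walks from [y] to
    [x]; then [no_poles] excludes [7 * K] arc-disjoint walks from [x] to [y], and Menger's theorem
    gives the cut. *)
Lemma separate_vertices x y : pos y + L <= pos x ->
  exists Z : {set vertex G}, [/\ y \in Z, x \notin Z & #|in_arcs Z| <= 7 * K].
Proof.
move=> yx; have xy : x != y by apply: contraTneq yx => ->; rewrite -ltnNge; lia.
have [[W [WW WD]]|//] := menger (7 * K) xy; exfalso.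
pose Mid := [set v | (pos y).+1 <= pos v < pos x].
have cardMid : #|Mid| = pos x - (pos y).+1 by apply/pos_card/ltnW/pos_lt.
pose B1 := [set m | (pos y < pos m) && adj m y].
pose B2 := [set m | (pos m < pos x) && adj x m].
apply: (@no_poles (Mid :\: (B1 :|: B2)) x y W) => //.
  have : #|B1 :|: B2| <= #|B1| + #|B2| := leq_card_setU B1 B2.
  have := card_back_in y; have := card_back_out x.
  have := subset_leq_card (subsetIr Mid (B1 :|: B2)).
  by rewrite -/B1 -/B2 cardsD cardMid; move: yx; rewrite /L; lia.
move=> m; rewrite !inE => /andP[+ /andP[ym mx]]; rewrite ym mx /= negb_or => /andP[my xm].
have ne1 : y != m by apply: contraTneq ym => ->; rewrite ltnn.
have ne2 : m != x by apply: contraTneq mx => ->; rewrite ltnn.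
have := adj_total sG ne1; have := adj_total sG ne2.
by rewrite (negbTE my) (negbTE xm) !orbF => -> ->.
Qed.

Let theta := c * (c * s * (7 * K)).

(* Backward arcs enter the first [i] positions only at [heads i] and leave the rest only at
   [tails (i + L)], so it is enough to separate these two bounded sets pairwise. *)
Lemma separate_positions i : exists Z : {set vertex G},
  [/\ [set v | pos v < i] \subset Z, Z \subset [set v | pos v < i + L]
    & #|in_arcs Z| <= theta].
Proof.
pose z (b a : vertex G) : {set vertex G} := odflt set0
  [pick Z : {set vertex G} | [&& a \in Z, b \notin Z & #|in_arcs Z| <= 7 * K]].
have zP b a : a \in heads i -> b \in tails (i + L) ->
    [/\ a \in z b a, b \notin z b a & #|in_arcs (z b a)| <= 7 * K].
  rewrite !inE => /andP[ai _] /andP[ib _].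
  have [|Z [aZ bZ Zc]] := @separate_vertices b a; first by lia.
  rewrite /z; case: pickP => [Z' /and3P[] //|/(_ Z)].
  by rewrite aZ bZ Zc.
(* This set contains every head and avoids every tail, and an arc entering it enters some
   [z b a]. *)
pose Z := \bigcup_(a in heads i) \bigcap_(b in tails (i + L)) z b a.
have headZ : heads i \subset Z.
  apply/subsetP => a ai; apply/bigcupP; exists a => //; apply/bigcapP => b bi.
  by have [] := zP b a ai bi.
have tailZ b : b \in tails (i + L) -> b \notin Z.
  move=> bi; apply/bigcupP => -[a ai /bigcapP/(_ b bi)].
  by have [_ /negP] := zP b a ai bi.
have cardZ : #|in_arcs Z| <= theta.
  apply: leq_trans (_ : #|heads i| * (c * s * (7 * K)) <= _); last first.
    by rewrite leq_mul2r card_heads orbT.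
  apply: leq_trans (card_bigcup_leq (A := heads i)
    (B := fun a => \bigcup_(b in tails (i + L)) in_arcs (z b a)) _); last first.
    move=> a ai; apply: leq_trans (card_bigcup_leq (m := 7 * K) _) _.
      by move=> b bi; have [] := zP b a ai bi.
    by rewrite leq_mul2r card_tails orbT.
  apply/subset_leq_card/subsetP => e; rewrite inE => /andP[+ /bigcupP[a ai eZ]].
  move=> /bigcupP srcZ; apply/bigcupP; exists a => //.
  have /existsP[b /andP[bi be]] : [exists b, (b \in tails (i + L)) && (src e \notin z b a)].
    rewrite -[[exists _, _]]negbK negb_exists; apply/negP => /forallP all_in.
    case: srcZ; exists a => //; apply/bigcapP => b bi; have := all_in b.
    by rewrite bi negbK.
  by apply/bigcupP; exists b => //; rewrite inE be; apply: (bigcapP eZ).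
pose P l := [set v | pos v < l].
(* Trimming creates no new entering arc: an arc going back over position [i] has its target in
   [heads i], hence in [Z], and one going back over [i + L] has its source in [tails (i + L)], hence
   outside [Z]. *)
exists ((Z :|: P i) :&: P (i + L)); split.
- by apply/subsetP => v; rewrite !inE => vi; rewrite vi orbT /=; lia.
- exact: subsetIr.
apply: leq_trans cardZ; apply/subset_leq_card/subsetP => e.
have crossing_head : pos (tgt e) < i -> i <= pos (src e) -> tgt e \in Z.
  move=> ti si; apply: (subsetP headZ); rewrite inE ti; apply/existsP; exists (src e).
  by rewrite si; apply/existsP; exists e; rewrite !eqxx.
rewrite !inE !negb_and !negb_or -!leqNgt.
case/andP=> /orP[/andP[sZ si]|sL] /andP[tZi tL].
  by rewrite sZ; case/orP: tZi => // /crossing_head -> .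
have -> /= : src e \notin Z.
  apply: tailZ; rewrite inE sL; apply/existsP; exists (tgt e).
  by rewrite tL; apply/existsP; exists e; rewrite !eqxx.
by case/orP: tZi => // ti; apply: crossing_head => //; lia.
Qed.

End Ordering.

(** * The Erdos-Posa argument *)

(** The sigma type makes both constants, which depend only on [H] and [k], available for defining
    [f] before [G] is given. *)
Lemma light_separators (H : digraph) (k : nat) : 0 < #|vertex H| ->
  {c : nat * nat | 0 < c.1 /\ forall G : digraph, semicomplete G -> ~ packed H k [set: diarc G] ->
    exists pos : vertex G -> nat,
    [/\ forall v, pos v < #|vertex G|,
        forall i j, #|[set v | i <= pos v < j]| <= j - i
      & forall i, exists Z : {set vertex G},
        [/\ [set v | pos v < i] \subset Z, Z \subset [set v | pos v < i + c.1]
          & #|in_arcs Z| <= c.2]]}.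
Proof.
(* The constants are left open, to be filled in by [separate_positions]. *)
move=> H0; eexists (_, _); split=> [|G sG np]; last first.
  have [pos [pos_lt pos_dec pos_card]] :=
    decreasing_order (fun u : vertex G => #|[set w | dominates u w]|).
  exists pos; split=> [//|i j|]; last first.
    by move=> i; apply: (separate_positions sG H0 np pos_lt pos_dec pos_card i).
  have [jV|/ltnW Vj] := leqP j #|vertex G|; first by rewrite pos_card.
  rewrite (leq_trans _ (leq_sub2r i Vj)) // -(pos_card i _ (leqnn _)).
  by apply/subset_leq_card/subsetP => v; rewrite !inE pos_lt andbT => /andP[].
by [].
Qed.

(** * Chains of vertex sets entered by few arcs *)

Section Chain.
Variables (G H : digraph) (k : nat).
Hypotheses (sH : strongly_connected H) (H2 : 2 <= #|vertex H|).
Hypothesis npacked : ~ packed H k [set: diarc G].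
Implicit Types (A X : {set diarc G}) (Z : {set vertex G}).

Definition arcs_in Z : {set diarc G} := [set a | (src a \in Z) && (tgt a \in Z)].

Lemma arcs_inS Z Z' : Z \subset Z' -> arcs_in Z \subset arcs_in Z'.
Proof.
move=> /subsetP ZZ'; apply/subsetP => a; rewrite !inE => /andP[/ZZ' -> /ZZ' ->] //.
Qed.

(** If [phi] maps into [Z], all walks end in [Z], so they never left it. If some [phi x0] is
    outside, strong connectivity leads from it to every [phi x] along walks that cannot enter
    [Z]. *)
Lemma immersed_split A Z : [disjoint A & in_arcs Z] -> immersed H A ->
  immersed H (A :&: arcs_in Z) \/ immersed H (A :&: arcs_in (~: Z)).
Proof.
move=> AZ [phi [P [inj W PA D]]].
have esc a : a \in A -> src a \notin Z -> tgt a \notin Z.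
  move=> aA sZ; have := disjointFr AZ aA; rewrite inE sZ /= => ->; exact: isT.
have [/forallP inZ|] := boolP [forall x, phi x \in Z].
  left; exists phi, P; split=> // e a ae; rewrite !inE (PA _ _ ae) /=.
  move: (PA e) (W e) (inZ (tgt e)) ae; move: (phi (src e)) (phi (tgt e)) (P e) => u v p.
  elim: p u => [|b p IHp] u //= pA /andP[_ pv] vZ.
  have pA' : {subset p <= A} by move=> x xp; apply: pA; rewrite inE xp orbT.
  have tZ : tgt b \in Z.
    by apply: contraTT vZ => tZ; have [] := diwalk_escape pA' esc pv tZ.
  rewrite inE => /predU1P[->|]; last exact: IHp pA' pv vZ.
  by rewrite tZ andbT; apply: contraTT tZ; apply: esc; apply: pA; rewrite mem_head.
rewrite negb_forall => /existsP[x0 x0Z].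
have outZ x : phi x \notin Z.
  have [p /andP[+ _]] := sH.2 x0 x.
  elim: p x0 x0Z => [|e p IHp] y yZ /=; first by move=> /eqP <-.
  case/andP=> /eqP s; apply: IHp; rewrite -s in yZ.
  by have [] := diwalk_escape (PA e) esc (W e) yZ.
right; exists phi, P; split=> // e a ae; rewrite !inE (PA _ _ ae) /=.
have [ez _] := diwalk_escape (PA e) esc (W e) (outZ _).
by have [-> ->] := ez _ ae.
Qed.

(** Strong connectivity and two vertices give [H] an arc [e], and [P e] is nonempty because [phi]
    separates the ends of [e]. *)
Lemma not_immersed0 : ~ immersed H (set0 : {set diarc G}).
Proof.
case=> phi [P [inj W PA _]].
have /card_gt1P[x [y [_ _ xy]]] : 1 < #|vertex H| by [].
have [[|e p]] := sH.2 x y; first by rewrite /dipath /= (negbTE xy).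
move=> _; have P0 : P e = [::].
  by case E: (P e) => [//|a q]; have := PA e a; rewrite E mem_head inE => /(_ isT).
have := W e; rewrite P0 /= => /eqP/inj/eqP; exact/negP/loopless.
Qed.

Lemma arcs_in0 : arcs_in set0 = set0.
Proof. by apply/setP => a; rewrite !inE. Qed.

Definition light := [set a : diarc G |
  #|[set b : diarc G | (src b == src a) && (tgt b == tgt a)]| < k * #|diarc H|].

Lemma card_light Z : #|light :&: arcs_in Z| <= #|Z| ^ 2 * (k * #|diarc H|).
Proof.
have -> : #|Z| ^ 2 = #|setX Z Z| by rewrite cardsX mulnn.
pose B (p : vertex G * vertex G) := [set a in light | (src a == p.1) && (tgt a == p.2)].
apply: leq_trans (card_bigcup_leq (A := setX Z Z) (B := B) _).
  apply/subset_leq_card/subsetP => a; rewrite !inE => /and3P[al sZ tZ].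
  by apply/bigcupP; exists (src a, tgt a); rewrite !inE ?sZ //= al !eqxx.
move=> [u v] _; have [->|[a]] := set_0Vmem (B (u, v)); first by rewrite cards0.
rewrite !inE /= => /and3P[al /eqP su /eqP tv]; apply: leq_trans (ltnW al).
by apply/subset_leq_card/subsetP => b; rewrite !inE su tv /= => /andP[].
Qed.

Lemma not_immersed_heavy A : A \subset ~: light -> ~ immersed H A.
Proof.
move=> /subsetP Al iA; apply: npacked; apply: packed_heavy iA _ => a /Al.
by rewrite !inE -leqNgt.
Qed.

Lemma first_true (P : nat -> Prop) l : ~ P 0 -> P l -> exists2 i, ~ P i & P i.+1.
Proof.
move=> P0; elim: l => // l IHl Pl; have [/IHl //|nPl] := classic (P l).
by exists l.
Qed.

Lemma packedS j A (A' F : {set diarc G}) : packed H j A -> immersed H F -> [disjoint A & F] ->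
  A \subset A' -> F \subset A' -> packed H j.+1 A'.
Proof.
move=> [Q [QD QP]] iF AF AA' FA'.
exists (fun i => if unlift ord0 i is Some i' then Q i' else F); split=> [i i'|i].
  case: unliftP => [l ->|->]; case: unliftP => [l' ->|->] //.
  - by rewrite (inj_eq lift_inj) => /QD.
  - by move=> _; have [QA _] := QP l; apply: disjointWl QA AF.
  - by move=> _; have [QA _] := QP l'; rewrite disjoint_sym; apply: disjointWl QA AF.
case: unliftP => [l _|_] //; have [QA iQ] := QP l; split=> //.
exact: subset_trans QA AA'.
Qed.

Variables (Z : nat -> {set vertex G}) (q theta L : nat).
Hypotheses (Zq : Z q = setT) (ZS : forall i, Z i \subset Z i.+1)
  (Zin : forall i, #|in_arcs (Z i)| <= theta)
  (Zblock : forall i, #|Z i.+1 :\: Z i| <= L).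

Let Z_mono i j : i <= j -> Z i \subset Z j.
Proof.
move=> /subnKC <-; elim: (j - i) => [|l IHl]; first by rewrite addn0.
by rewrite addnS; apply: subset_trans IHl (ZS _).
Qed.

(** Each step pays for two cuts of the chain and for the light arcs inside one block. *)
Let cost := 2 * theta + L ^ 2 * (k * #|diarc H|).

Lemma erdos_posa_chain j i : packed H j (arcs_in (~: Z i)) \/
  exists X, #|X| <= j * cost /\ ~ immersed H (arcs_in (~: Z i) :\: X).
Proof.
elim: j i => [|j IHj] i; first by left; exists (fun=> set0); split; case.
pose F l := arcs_in (Z (i + l) :\: Z i).
have F0 : ~ immersed H (F 0) by rewrite /F addn0 setDv arcs_in0; apply: not_immersed0.
have [iFq|niFq] := classic (immersed H (F q)); last first.
  right; exists set0; rewrite cards0 setD0; split=> //.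
  suff -> : ~: Z i = Z (i + q) :\: Z i by [].
  have /eqP -> : Z (i + q) == setT.
    by rewrite -subTset -Zq Z_mono // leq_addl.
  by rewrite setTD.
(* At [l] the stretch beyond [Z i] begins to contain [H]; [F l.+1] supplies one copy, disjoint from
   anything packed outside [Z (i + l.+1)]. *)
have [l nFl Fl] := @first_true (fun l => immersed H (F l)) q F0 iFq.
have mono1 : Z i \subset Z (i + l) by rewrite Z_mono // leq_addr.
have mono2 : Z (i + l) \subset Z (i + l.+1) by rewrite addnS.
have [pk|[X [Xle Xni]]] := IHj (i + l.+1).
  left; apply: packedS pk Fl _ _ _.
  - rewrite -setI_eq0; apply/eqP/setP => a; rewrite !inE.
    by case: (src a \in Z (i + l.+1)); rewrite ?andbF.
  - by apply/arcs_inS; rewrite setCS (subset_trans mono1).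
  - by apply/arcs_inS/subsetP => v; rewrite !inE => /andP[].
right; pose B := Z (i + l.+1) :\: Z (i + l).
pose X' := X :|: in_arcs (Z (i + l.+1)) :|: in_arcs (Z (i + l)) :|: (light :&: arcs_in B).
exists X'; split.
  have cU (S1 S2 : {set diarc G}) : #|S1 :|: S2| <= #|S1| + #|S2| := leq_card_setU S1 S2.
  have c1 := cU (X :|: in_arcs (Z (i + l.+1)) :|: in_arcs (Z (i + l))) (light :&: arcs_in B).
  have c2 := cU (X :|: in_arcs (Z (i + l.+1))) (in_arcs (Z (i + l))).
  have c3 := cU X (in_arcs (Z (i + l.+1))).
  have c4 := Zin (i + l.+1); have c5 := Zin (i + l).
  have c6 : #|light :&: arcs_in B| <= L ^ 2 * (k * #|diarc H|).
    apply: leq_trans (card_light B) _; rewrite leq_mul2r leq_sqr.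
    by rewrite /B addnS Zblock orbT.
  rewrite -/X' in c1; rewrite mulSn /cost; move: c6; lia.
set A := arcs_in (~: Z i) :\: X' => iA.
have AP a : a \in A -> [/\ a \in arcs_in (~: Z i), a \notin X, a \notin in_arcs (Z (i + l.+1)),
    a \notin in_arcs (Z (i + l)) & a \notin light :&: arcs_in B].
  by rewrite in_setD /X' !in_setU !negb_or => /andP[/andP[/andP[/andP[-> ->] ->] ->] ->].
have sub1 : [disjoint A & in_arcs (Z (i + l.+1))].
  by apply/pred0P => a /=; apply/negP => /andP[/AP[_ _ /negP]].
(* An immersion avoiding [X'] lies in one of three regions: outside [Z (i + l.+1)], against the
   choice of [X]; inside [Z (i + l)], against that of [l]; or in [B], where only heavy arcs are
   left. *)
have [iA1|iA1] := immersed_split sub1 iA; last first.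
  apply: Xni; apply: immersedS iA1; apply/subsetP => a; rewrite in_setI in_setD.
  by case/andP=> /AP[_ -> _ _ _] ->.
have sub2 : [disjoint A :&: arcs_in (Z (i + l.+1)) & in_arcs (Z (i + l))].
  by apply/pred0P => a /=; apply/negP => /andP[/setIP[/AP[_ _ _ /negP]]].
have [iA2|iA2] := immersed_split sub2 iA1.
  apply: nFl; apply: immersedS iA2; apply/subsetP => a /setIP[/setIP[/AP[+ _ _ _ _] _]].
  by rewrite !inE => /andP[-> ->] /andP[-> ->].
apply: (@not_immersed_heavy _ _ iA2); apply/subsetP => a.
case/setIP=> /setIP[/AP[_ _ _ _ +] aZ'] aZ; rewrite in_setC; apply: contra => al.
rewrite in_setI al /=; move: aZ' aZ; rewrite !inE.
by move=> /andP[-> ->] /andP[-> ->].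
Qed.

End Chain.

Theorem theorem3 (H : digraph) (sH : strongly_connected H)
  (H2 : 2 <= #|vertex H|) :
  exists f : nat -> nat,
  forall (G : digraph) (sG : semicomplete G) (k : nat) (k0 : 0 < k),
  (exists S : 'I_k -> subdigraph G,
     (forall i j : 'I_k, i != j -> [disjoint sub_arcs (S i) & sub_arcs (S j)]) /\
     (forall i : 'I_k, immersion H (digraph_of_sub (S i))))
  \/
  (exists X : {set diarc G}, #|X| <= f k /\ ~ immersion H (delete_arcs X)).
Proof.
pose c k := sval (light_separators k sH.1).
exists (fun k => k * (2 * (c k).2 + (2 * (c k).1) ^ 2 * (k * #|diarc H|))).
move=> G sG k k0; have [pk|npk] := classic (packed H k [set: diarc G]).
  by left; apply: packed_subdigraphs pk.
right; have [L0 /(_ G sG npk)[pos [pos_lt pos_card sep]]] := svalP (light_separators k sH.1).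
rewrite -/(c k) in L0 sep; case: (c k) L0 sep => L th /= L0 sep.
pose ok i (Y : {set vertex G}) := [&& [set v | pos v < i * L] \subset Y,
  Y \subset [set v | pos v < i * L + L] & #|in_arcs Y| <= th].
have okP i : exists Y, ok i Y.
  by have [Y [? ? ?]] := sep (i * L); exists Y; apply/and3P.
(* Starting from the empty set makes the complement of [Z 0] everything; later sets cut at
   successive multiples of [L]. *)
pose Z i := if i is i'.+1 then xchoose (okP i') else set0.
have ZP i : [/\ [set v | pos v < i * L] \subset Z i.+1,
    Z i.+1 \subset [set v | pos v < i.+1 * L] & #|in_arcs (Z i.+1)| <= th].
  by have /and3P := xchooseP (okP i); rewrite mulSnr.
(* As [0 < L], every position is below [#|vertex G| * L]. *)
have Zq : Z #|vertex G|.+1 = setT.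
  have [/subsetP lo _ _] := ZP #|vertex G|; apply/setP => v; rewrite in_setT; apply: lo.
  by rewrite inE (leq_trans (pos_lt v)) // leq_pmulr.
have ZS i : Z i \subset Z i.+1.
  case: i => [|i]; first exact: sub0set.
  by have [_ hi _] := ZP i; have [lo _ _] := ZP i.+1; apply: subset_trans hi lo.
have Zin i : #|in_arcs (Z i)| <= th.
  case: i => [|i]; last by have [] := ZP i.
  by rewrite (_ : in_arcs _ = set0) ?cards0 //; apply/setP => a; rewrite !inE andbF.
(* The difference lies between positions [i.-1 * L] and [i.+1 * L]; for [i = 0] the truncated
   predecessor gives the bound zero. *)
have Zblock i : #|Z i.+1 :\: Z i| <= 2 * L.
  apply: leq_trans (_ : i.+1 * L - i.-1 * L <= _); last first.
    by rewrite -mulnBl leq_mul2r; apply/orP; right; lia.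
  apply: leq_trans (pos_card _ _); apply/subset_leq_card/subsetP => v.
  have [_ /subsetP hi _] := ZP i; case/setDP=> /hi; rewrite !inE => -> vi.
  case: i vi {hi} => [//|i] vi.
  have [/subsetP lo _ _] := ZP i; rewrite leqNgt andbT; apply: contra vi => vi.
  by apply: lo; rewrite inE.
have [[F [FD FP]]|[X [Xle Xni]]] :=
  @erdos_posa_chain G H k sH H2 npk Z _ th (2 * L) Zq ZS Zin Zblock k 0.
  by case: npk; exists F; split=> // i; have [_ ?] := FP i; split; rewrite ?subsetT.
exists X; split=> // /immersion_immersed iX; apply: Xni; apply: immersedS iX.
by apply/subsetP => a; rewrite !inE => ->.
Qed.
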